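(* Let $(X,d)$ be a controlled metric type space with control function $\alpha : X\times X\to[1,\infty)$, and let $r\ge 0$ be a real number. If $\sup_{x,y\in X}\alpha(x,y)$ exists (is finite) and equals $k$, then every $r$-convergent sequence in $(X,d)$ is bounded.
   Context: A controlled metric type space is a nonempty set $X$ with functions $\alpha: X\times X\to[1,\infty)$ and $d:X\times X\to[0,\infty)$ such that for all $x,y,z\in X$: $d(x,y)=0$ iff $x=y$; $d(x,y)=d(y,x)$; and $d(x,y)\le \alpha(x,z)d(x,z)+\alpha(z,y)d(z,y)$. (No symmetry of $\alpha$ is assumed.) For a real $r\ge0$, a sequence $\{x_n\}_{n\in\mathbb N}$ in $X$ is $r$-convergent (rough convergent of roughness degree $r$) to $x\in X$ if for every $\varepsilon>0$ there is $n_0\in\mathbb N$ with $d(x_n,x)<r+\varepsilon$ for all $n\ge n_0$; it is $r$-convergent if it is $r$-convergent to some $x\in X$. A sequence $\{x_n\}$ is bounded if there is a real $B>0$ with $d(x_n,x_m)<B$ for all $m,n\in\mathbb N$. *)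

(* Defs.v *)
From mathcomp Require Import all_boot all_order all_algebra.
From mathcomp Require Import boolp classical_sets reals.

Set Implicit Arguments.
Unset Strict Implicit.
Unset Printing Implicit Defensive.
Import Order.TTheory GRing.Theory Num.Theory.

Local Open Scope classical_set_scope.
Local Open Scope ring_scope.

(* The control function alpha is not assumed symmetric, so the order of the
   arguments in the triangle inequality matters. *)
Record controlled_metric_type (R : realType) (X : Type)
    (alpha d : X -> X -> R) : Prop := ControlledMetricType {
  cmt_inhabited : inhabited X;
  cmt_alpha_ge1 : forall x y, 1 <= alpha x y;
  cmt_ge0 : forall x y, 0 <= d x y;
  cmt_eq0 : forall x y, d x y = 0 <-> x = y;
  cmt_sym : forall x y, d x y = d y x;
  cmt_triangle : forall x y z,
    d x y <= alpha x z * d x z + alpha z y * d z y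
}.

Definition rough_cvg_to (R : realType) (X : Type) (d : X -> X -> R) (r : R)
    (u : nat -> X) (x : X) : Prop :=
  forall eps : R, 0 < eps ->
    exists n0 : nat, forall n : nat, (n0 <= n)%N -> d (u n) x < r + eps.

Definition rough_cvg (R : realType) (X : Type) (d : X -> X -> R) (r : R)
    (u : nat -> X) : Prop :=
  exists x : X, rough_cvg_to d r u x.

Definition bounded_sequence (R : realType) (X : Type) (d : X -> X -> R)
    (u : nat -> X) : Prop :=
  exists B : R, 0 < B /\ forall m n : nat, d (u n) (u m) < B.

(* [sup] is a total function, with junk value 0 on sets that have no supremum,
   hence the conjunct [has_sup A]. *)
Definition sup_exists_eq (R : realType) (A : set R) (k : R) : Prop :=
  has_sup A /\ sup A = k.

(* Main.v *)
(* An r-convergent sequence is eventually within r + 1 of its rough limit x,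
   hence within some D of x for all indices; the triangle inequality through x
   then gives d (u m) (u n) <= 2 k D. *)
Require Import Defs.
From mathcomp Require Import all_boot all_order all_algebra.
From mathcomp Require Import boolp classical_sets reals.

Set Implicit Arguments.
Unset Strict Implicit.
Unset Printing Implicit Defensive.
Import Order.TTheory GRing.Theory Num.Theory.

Local Open Scope classical_set_scope.
Local Open Scope ring_scope.

(** The finite supremum replaces the variable weights [alpha] by the single constant [k], so the
    triangle inequality through the rough limit is uniform in both indices. Only finitely many terms
    escape the tail estimate, and [eventually_le_bounded] absorbs them. *)

Lemma eventually_le_bounded (R : numDomainType) (f : nat -> R) (n0 : nat)
    (C : R) :
  (forall n, 0 <= f n) -> 0 <= C -> (forall n, (n0 <= n)%N -> f n <= C) ->
  exists2 D : R, 0 <= D & forall n, f n <= D.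
Proof.
(* By nonnegativity, the sum of the first [n0] terms dominates each of them, so it can stand in for
   their maximum. *)
move=> f0 C0 fC; exists (C + \sum_(i < n0) f i).
  by rewrite addr_ge0 ?sumr_ge0.
move=> n; case: (leqP n0 n) => [le_n|lt_n].
  by rewrite (le_trans (fC n le_n))// lerDl sumr_ge0.
rewrite (bigD1 (Ordinal lt_n))//= addrCA lerDl.
by rewrite addr_ge0 ?sumr_ge0.
Qed.

Theorem theorem3p10 (R : realType) (X : Type) (alpha d : X -> X -> R)
    (hX : controlled_metric_type alpha d) (r : R) (hr : 0 <= r) (k : R)
    (hk : sup_exists_eq [set alpha x y | x in [set: X] & y in [set: X]] k)
    (u : nat -> X) (hu : rough_cvg d r u) :
  bounded_sequence d u.
Proof.
case: hX => _ alpha_ge1 d_ge0 _ d_sym d_tri; case: hk => -[_ alpha_ub] sup_k.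
have alpha_le x y : alpha x y <= k.
  by rewrite -sup_k; apply: ub_le_sup => //; exists x => //; exists y.
case: hu => x /(_ 1 ltr01)[n0 near_x].
have [D D_ge0 dD] : exists2 D : R, 0 <= D & forall n, d (u n) x <= D.
  apply: (@eventually_le_bounded _ _ n0 (r + 1)) => //.
    by rewrite addr_ge0.
  by move=> n /near_x /ltW.
have k_ge0 : 0 <= k by rewrite (le_trans _ (alpha_le x x))// (le_trans ler01).
(* The extra [1] makes the bound positive and strict even when [D] is 0. *)
exists (k * D + k * D + 1); split; first by rewrite ltr_wpDl// addr_ge0// mulr_ge0.
move=> m n; rewrite (le_lt_trans (d_tri _ _ x))// ltr_pwDr//.
have alpha_ge0 y z : 0 <= alpha y z by rewrite (le_trans ler01).
by rewrite lerD// ler_pM// d_sym.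
Qed.
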